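(* The function $\operatorname{cov}$ is a packing bound function. It is the maximal packing bound function among all packing bound functions (i.e., every packing bound function $A$ satisfies $A(C)\le\operatorname{cov}(C)$ for all $C\in\mathcal{B}$), and it does not satisfy the Euclidean bound.
   Context: For a bounded Borel set $C\subseteq\mathbb{R}^d$, $\operatorname{cov}(C)$ is the size of the smallest covering of $C$ by open balls of radius $1$ (with centers not necessarily in $C$), i.e., the infimum of $|X|$ over subsets $X\subseteq\mathbb{R}^d$ such that $C\subseteq X(1)$. (This does not depend on the ambient space in which $C$ is considered.) Let $\mathcal{B}_d$ be the set of all bounded Borel subsets of $\mathbb{R}^d$ and $\mathcal{B} = \bigcup_d \mathcal{B}_d$. Write $d(x,y)=|x-y|$ for the Euclidean metric, $d(C,C') = \inf\{d(x,x') : x\in C, x'\in C'\}$ (equal to $\infty$ if $C$ or $C'$ is empty), and $C(\varepsilon) = \{x \in \mathbb{R}^d : d(x,C)<\varepsilon\}$ for $C \subseteq \mathbb{R}^d$. A function $\psi\colon C \to C'$ (possibly between subsets of Euclidean spaces of different dimensions) is distance-increasing if $d(\psi(x),\psi(y)) \ge d(x,y)$ for all $x,y\in C$. A packing bound function is a map $A\colon \mathcal{B}\to[0,\infty)$ such that for all $C,C'\in\mathcal{B}$ and $\varepsilon>0$: (1) (Sphere bound) if $C$ is nonempty and contained in the interior of a ball of radius $1$, then $A(C)=1$; (2) (Lipschitz inequality) if there exists a distance-increasing function $\psi\colon C\to C'$, then $A(C)\le A(C')$; (3) (Union axiom) if $C$ and $C'$ are subsets of the same ambient space $\mathbb{R}^d$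 and $d(C,C')\ge 2$, then $A(C\cup C')=A(C)+A(C')$; (4) (Mesh axiom) if $C \subseteq C'(\varepsilon)$ (in the same ambient space), then $A(\frac{1}{1+\varepsilon}C)\le A(C')$. For a packing bound function $A$ and $n\ge1$, $\delta_{A,n}=\lim_{k\to\infty}A(2^kI^n)/2^{kn}$, where $I^n=[0,1]^n$; this limit always exists and is positive. $A$ satisfies the Euclidean bound if for every $n$, every bounded Borel subset $C\subseteq\mathbb{R}^n$ satisfies $A(C)\ge\delta_{A,n}\mathcal{L}_n(C)$, where $\mathcal{L}_n$ is Lebesgue measure. *)

(* Defs.v *)
From HB Require Import structures.
From mathcomp Require Import all_boot all_order all_algebra.
From mathcomp Require Import all_classical all_reals all_analysis.

Set Implicit Arguments.
Unset Strict Implicit.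
Unset Printing Implicit Defensive.

Import Order.TTheory GRing.Theory Num.Theory.
Import numFieldNormedType.Exports.

Local Open Scope classical_set_scope.
Local Open Scope ring_scope.

(* The norm carried by 'rV[R]_d in the library is the sup norm, so the
   Euclidean metric is defined here; both induce the same topology and the same
   bounded sets, for which the library notions are used. *)
Definition enorm (R : realType) d (x : 'rV[R]_d) : R :=
  Num.sqrt (\sum_(i < d) x ord0 i ^+ 2).

Definition edist (R : realType) d (x y : 'rV[R]_d) : R := enorm (x - y).

Definition set_edist (R : realType) d (C C' : set 'rV[R]_d) : \bar R :=
  ereal_inf [set r | exists x y, [/\ C x, C' y & r = (edist x y)%:E]].

Definition enbhd (R : realType) d (C : set 'rV[R]_d) (e : R) :
    set 'rV[R]_d :=
  [set x | (set_edist [set x] C < e%:E)%E].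

Definition closed_eball (R : realType) d (c : 'rV[R]_d) (r : R) :
    set 'rV[R]_d :=
  [set x | edist c x <= r].

Definition set_scale (R : realType) d (a : R) (C : set 'rV[R]_d) :
    set 'rV[R]_d :=
  [set a *: x | x in C].

Definition bounded_borel (R : realType) d (C : set 'rV[R]_d) : Prop :=
  bounded_set C /\ <<s [set U : set 'rV[R]_d | open U] >> C.

(* Functions on the union over d of the bounded Borel subsets of R^d are
   families of total functions whose values off the bounded Borel sets are
   irrelevant. *)
Definition borel_set_function (R : realType) := forall d, set 'rV[R]_d -> R.

Definition distance_increasing (R : realType) d d' (C : set 'rV[R]_d)
    (psi : 'rV[R]_d -> 'rV[R]_d') : Prop :=
  forall x y, C x -> C y -> edist x y <= edist (psi x) (psi y).

Record packing_bound_function (R : realType) (A : borel_set_function R) : Prop := {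
  pbf_ge0 : forall d (C : set 'rV[R]_d), bounded_borel C -> 0 <= A d C;
  pbf_sphere : forall d (C : set 'rV[R]_d), bounded_borel C ->
    C !=set0 -> (exists c, C `<=` (closed_eball c 1)°) -> A d C = 1;
  pbf_lipschitz : forall d d' (C : set 'rV[R]_d) (C' : set 'rV[R]_d'),
    bounded_borel C -> bounded_borel C' ->
    (exists psi : 'rV[R]_d -> 'rV[R]_d',
      {homo psi : x / C x >-> C' x} /\ distance_increasing C psi) ->
    A d C <= A d' C';
  pbf_union : forall d (C C' : set 'rV[R]_d),
    bounded_borel C -> bounded_borel C' ->
    (2%:E <= set_edist C C')%E -> A d (C `|` C') = A d C + A d C';
  pbf_mesh : forall d (C C' : set 'rV[R]_d) (e : R),
    bounded_borel C -> bounded_borel C' -> 0 < e ->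
    C `<=` enbhd C' e -> A d (set_scale (1 + e)^-1 C) <= A d C'
}.

Definition unit_cube (R : realType) n : set 'rV[R]_n :=
  [set x | forall i, 0 <= x ord0 i <= 1].

Definition pbf_density (R : realType) (A : borel_set_function R) n : R :=
  limn (fun k => A n (set_scale (2 ^+ k) (@unit_cube R n)) / 2 ^+ (k * n)).

(* The n-fold product of the Lebesgue measure on R: the successor case is
   product_measure1 written out along the splitting R^(1+n) = R x R^n. It is
   only meaningful on Borel sets. *)
Fixpoint lebesgue_measure_rV (R : realType) n : set 'rV[R]_n -> \bar R :=
  match n with
  | 0%N => fun C => (\1_C (0 : 'rV[R]_0))%:E
  | n.+1 => fun C => (\int[@lebesgue_measure R]_t
      lebesgue_measure_rV [set x : 'rV[R]_n | C (row_mx t%:M x : 'rV[R]_n.+1)])%E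
  end.

Definition euclidean_bound (R : realType) (A : borel_set_function R) : Prop :=
  forall n (C : set 'rV[R]_n), (0 < n)%N -> bounded_borel C ->
    ((pbf_density A n)%:E * lebesgue_measure_rV C <= (A n C)%:E)%E.

(* The infimum is finite for bounded C, so that fine loses nothing. *)
Definition cov (R : realType) : borel_set_function R := fun d C =>
  fine (ereal_inf [set counting X | X in [set X : set 'rV[R]_d | C `<=` enbhd X 1]]).

(* Main.v *)
(** cov is monotone under distance-increasing maps because the inverse map is
    a contraction, and by Kirszbraun's theorem (for one additional point) a
    contraction maps a part of an open unit ball into an open unit ball.

    Maximality: let C be covered by n unit balls. Lifting each point of C into
    R^(d+1), at a height determined by a ball containing it, is
    distance-increasing and lands in a tower of n unit balls at mutual distance
    at least 2, on which every packing bound function takes the value n.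

    The Euclidean bound fails in the plane since coverings by discs must
    overlap. Let delta be the covering density. The bound, applied to the union
    of the small squares at the points of a fine lattice lying in a unit disc,
    says that delta times the area of a disc (measured by counting lattice
    points) is at most 1, up to a factor close to 1. In a covering every square
    of side 8 contains a disc of radius 1/100 that is covered twice, so counting
    lattice points with multiplicity in a covering of a large square shows that
    delta is at least (1 + eta) delta for some constant eta > 0. *)

From Pilot Require Import Defs.
From mathcomp Require Import all_boot all_order all_algebra.
From mathcomp Require Import all_classical all_reals all_analysis.
From mathcomp Require Import measurable_realfun ring lra.
(* all_analysis has its own [edist], which must not shadow the Euclidean one. *)
Import Pilot.Defs.

Set Implicit Arguments.
Unset Strict Implicit.
Unset Printing Implicit Defensive.

Import Order.TTheory GRing.Theory Num.Theory.
Import numFieldNormedType.Exports.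

Local Open Scope classical_set_scope.
Local Open Scope ring_scope.

(** * The Euclidean norm *)

Section EuclideanNorm.
Context {R : realType} {d : nat}.
Implicit Types (x y z : 'rV[R]_d) (C : set 'rV[R]_d).

Definition edot x y : R := \sum_(i < d) x ord0 i * y ord0 i.

Lemma edotC x y : edot x y = edot y x.
Proof. by apply: eq_bigr => i _; rewrite mulrC. Qed.

Lemma edotDl x y z : edot (x + y) z = edot x z + edot y z.
Proof. by rewrite -big_split; apply: eq_bigr => i _; rewrite mxE mulrDl. Qed.

Lemma edotZl a x y : edot (a *: x) y = a * edot x y.
Proof. by rewrite mulr_sumr; apply: eq_bigr => i _; rewrite mxE mulrA. Qed.

Lemma edotDr x y z : edot x (y + z) = edot x y + edot x z.
Proof. by rewrite edotC edotDl !(edotC x). Qed.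

Lemma edotZr a x y : edot x (a *: y) = a * edot x y.
Proof. by rewrite edotC edotZl edotC. Qed.

Lemma edotNl x y : edot (- x) y = - edot x y.
Proof. by rewrite -scaleN1r edotZl mulN1r. Qed.

Lemma edotNr x y : edot x (- y) = - edot x y.
Proof. by rewrite edotC edotNl edotC. Qed.

Lemma edot0l x : edot 0 x = 0.
Proof. by rewrite -(scale0r 0) edotZl mul0r. Qed.

Lemma edot0r x : edot x 0 = 0.
Proof. by rewrite edotC edot0l. Qed.

Definition edotE := (edotDl, edotDr, edotNl, edotNr, edotZl, edotZr, edot0l, edot0r).

Lemma edot_ge0 x : 0 <= edot x x.
Proof. by apply: sumr_ge0 => i _; rewrite -expr2 sqr_ge0. Qed.

Lemma edotxx_eq0 x y : edot x x = 0 -> edot x y = 0.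
Proof.
move=> /eqP; rewrite psumr_eq0 => [/allP x0|i _]; last by rewrite -expr2 sqr_ge0.
apply: big1 => i _; have := x0 i (mem_index_enum _).
by rewrite mulf_eq0 orbb => /eqP ->; rewrite mul0r.
Qed.

Lemma enormE x : enorm x = Num.sqrt (edot x x).
Proof. by congr Num.sqrt; apply: eq_bigr => i _; rewrite expr2. Qed.

Lemma enorm_ge0 x : 0 <= enorm x.
Proof. exact: sqrtr_ge0. Qed.

Lemma sqr_enorm x : enorm x ^+ 2 = edot x x.
Proof. by rewrite enormE sqr_sqrtr// edot_ge0. Qed.

Lemma enorm_le x r : 0 <= r -> (enorm x <= r) = (edot x x <= r ^+ 2).
Proof. by move=> r0; rewrite -sqr_enorm ler_sqr ?nnegrE ?enorm_ge0. Qed.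

Lemma enorm_lt x r : 0 <= r -> (enorm x < r) = (edot x x < r ^+ 2).
Proof. by move=> r0; rewrite -sqr_enorm ltr_sqr ?nnegrE ?enorm_ge0. Qed.

Lemma enormZ a x : enorm (a *: x) = `|a| * enorm x.
Proof. by rewrite !enormE !edotE mulrA -expr2 sqrtrM ?sqr_ge0// sqrtr_sqr. Qed.

Lemma enormN x : enorm (- x) = enorm x.
Proof. by rewrite -scaleN1r enormZ normrN1 mul1r. Qed.

Lemma enorm0 : enorm (0 : 'rV[R]_d) = 0.
Proof. by rewrite enormE edot0l sqrtr0. Qed.

(** Cauchy-Schwarz: expand the square of [enorm y *: x - enorm x *: y]. *)
Lemma edot_le x y : edot x y <= enorm x * enorm y.
Proof.
have [x0|x0] := eqVneq (enorm x) 0.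
  by rewrite x0 mul0r edotxx_eq0// -sqr_enorm x0 expr0n.
have [y0|y0] := eqVneq (enorm y) 0.
  by rewrite y0 mulr0 edotC edotxx_eq0// -sqr_enorm y0 expr0n.
have xp : 0 < enorm x by rewrite lt_neqAle eq_sym x0 enorm_ge0.
have yp : 0 < enorm y by rewrite lt_neqAle eq_sym y0 enorm_ge0.
have := edot_ge0 (enorm y *: x - enorm x *: y).
rewrite !edotE -!sqr_enorm (edotC y x) => h.
have xyp : 0 < enorm x * enorm y by rewrite mulr_gt0.
rewrite -(ler_pM2l xyp); nra.
Qed.

Lemma enormD x y : enorm (x + y) <= enorm x + enorm y.
Proof.
rewrite enorm_le ?addr_ge0 ?enorm_ge0// !edotE (edotC y x) -!sqr_enorm.
have := edot_le x y; nra.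
Qed.

Lemma coord_le_enorm x i : `|x ord0 i| <= enorm x.
Proof.
rewrite -ler_sqr ?nnegrE ?enorm_ge0// real_normK ?num_real// sqr_enorm /edot (bigD1 i)//=.
by rewrite -expr2 lerDl sumr_ge0// => j _; rewrite -expr2 sqr_ge0.
Qed.

Lemma enorm_le_coord x e : 0 <= e -> (forall i, `|x ord0 i| <= e) ->
  enorm x <= d%:R * e.
Proof.
move=> e0 xe; rewrite enorm_le ?mulr_ge0// exprMn.
have -> : edot x x = \sum_(i < d) `|x ord0 i| ^+ 2.
  by apply: eq_bigr => i _; rewrite real_normK ?num_real// expr2.
have /le_trans -> // : \sum_(i < d) `|x ord0 i| ^+ 2 <= \sum_(i < d) e ^+ 2.
  by apply: ler_sum => i _; rewrite ler_sqr ?nnegrE.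
rewrite sumr_const card_ord -[leLHS]mulr_natl ler_wpM2r ?sqr_ge0// -natrX ler_nat.
by case: (d) => // n; rewrite leq_pmulr.
Qed.

Lemma edist_ge0 x y : 0 <= edist x y.
Proof. exact: enorm_ge0. Qed.

Lemma edistC x y : edist x y = edist y x.
Proof. by rewrite /edist -enormN opprB. Qed.

Lemma edistxx x : edist x x = 0.
Proof. by rewrite /edist subrr enorm0. Qed.

Lemma edist_triangle y x z : edist x z <= edist x y + edist y z.
Proof. by rewrite /edist; apply: le_trans (enormD _ _); rewrite addrA subrK. Qed.

Lemma edistDr z x y : edist (x + z) (y + z) = edist x y.
Proof. by rewrite /edist opprD addrACA subrr addr0. Qed.

Lemma edistZ a x y : edist (a *: x) (a *: y) = `|a| * edist x y.
Proof. by rewrite /edist -scalerBr enormZ. Qed.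

Lemma enbhdP C e x : enbhd C e x <-> exists2 y, C y & edist x y < e.
Proof.
split=> [/ereal_inf_lt [_ [z [y [/= -> Cy ->]]]]|[y Cy xy]].
  by rewrite lte_fin => xy; exists y.
apply: le_lt_trans (_ : (edist x y)%:E < _)%E; last by rewrite lte_fin.
by apply: ereal_inf_lbound; exists x, y.
Qed.

Lemma set_edist_ge C C' r :
  (r%:E <= set_edist C C')%E <-> forall x y, C x -> C' y -> r <= edist x y.
Proof.
split=> [h x y Cx Cy|h].
  by rewrite -lee_fin (le_trans h)//; apply: ereal_inf_lbound; exists x, y.
by apply: le_ereal_inf_tmp => _ [x [y [Cx Cy ->]]]; rewrite lee_fin h.
Qed.

Lemma bounded_rowP C :
  bounded_set C <-> exists M, forall x, C x -> forall i, `|x ord0 i| <= M.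
Proof.
split=> [[M [_ hM]]|[M hM]].
  exists (M + 1) => x Cx i; apply: le_trans (hM _ (ltr_pwDr ltr01 (lexx M)) x Cx).
  rewrite [leRHS]/Num.norm/= mx_normrE.
  by apply/bigmax_geP; right; exists (ord0, i).
exists `|M|; split=> [|N MN x Cx]; first exact: num_real.
apply: le_trans (ltW MN).
rewrite [leLHS]/Num.norm/= mx_normrE; apply: bigmax_le => // -[i j] _ /=.
by rewrite ord1 (le_trans (hM x Cx j))// ler_norm.
Qed.

Lemma bounded_set_enorm C :
  bounded_set C <-> exists M, forall x, C x -> enorm x <= M.
Proof.
split=> [/bounded_rowP[M hM]|[M hM]]; last first.
  by apply/bounded_rowP; exists M => x Cx i; rewrite (le_trans (coord_le_enorm _ _))// hM.
exists (d%:R * `|M|) => x Cx; apply: enorm_le_coord => // i.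
by rewrite (le_trans (hM x Cx i))// ler_norm.
Qed.

Lemma bounded_eball C (c : 'rV[R]_d) (r : R) : (forall x, C x -> edist c x <= r) -> bounded_set C.
Proof.
move=> h; apply/bounded_set_enorm; exists (enorm c + r) => x Cx.
have -> : x = c + (x - c) by rewrite addrC subrK.
by rewrite (le_trans (enormD _ _))// lerD2l; have := h x Cx; rewrite edistC.
Qed.

Lemma coord_ball_edist (c : 'rV[R]_d) (e : R) : 0 < e ->
  exists2 r, 0 < r & forall x, (forall i, `|x ord0 i - c ord0 i| < r) -> edist c x < e.
Proof.
move=> e0; exists (e / d.+1%:R); first by rewrite divr_gt0.
move=> x h; rewrite edistC /edist.
apply: le_lt_trans (enorm_le_coord (e := e / d.+1%:R) _ _) _ => [|i|].
- by rewrite divr_ge0// ltW.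
- by rewrite !mxE ltW.
- by rewrite mulrA ltr_pdivrMr// mulrC ltr_pM2l// ltr_nat.
Qed.

Lemma open_eball (c : 'rV[R]_d) (r : R) : open [set x : 'rV[R]_d | edist c x < r].
Proof.
rewrite openE => x /= cx.
have r0 : 0 < r - edist c x by rewrite subr_gt0.
have [e e0 he] := coord_ball_edist x r0.
apply/nbhs_ballP; exists e => //= y [_ xy] /=.
apply: le_lt_trans (edist_triangle x _ _) _.
rewrite -ltrBrDl; apply: he => i.
by have := xy ord0 i; rewrite /ball/= distrC.
Qed.

Lemma interior_closed_eball (c : 'rV[R]_d) :
  (closed_eball c 1)° = [set x : 'rV[R]_d | edist c x < 1].
Proof.
apply/seteqP; split=> x /=; last first.
  move=> cx; apply: (@filterS _ (nbhs x) _ [set y | edist c y < 1]).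
    by move=> y /= /ltW.
  by apply: open_nbhs_nbhs; split; first exact: open_eball.
move=> /nbhs_ballP [e /= e0 he].
rewrite ltNge; apply/negP => cx.
(* If [1 <= edist c x], moving [x] away from [c] by the factor [1 + t] leaves the closed ball, while
   this [t] keeps the move below [e] in every coordinate. *)
pose t := e / (2 * (1 + enorm (x - c))).
have h1 : 0 < 1 + enorm (x - c) by rewrite ltr_pwDl// enorm_ge0.
have t0 : 0 < t by rewrite divr_gt0// mulr_gt0.
have := he (x + t *: (x - c)).
have -> : closed_eball c 1 (x + t *: (x - c)) = ((1 + t) * edist c x <= 1) :> Prop.
  rewrite /closed_eball/= edistC (edistC c) /edist.
  have -> : x + t *: (x - c) - c = (1 + t) *: (x - c).
    by rewrite scalerDl scale1r addrAC.
  by rewrite enormZ gtr0_norm// addr_gt0.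
apply/not_implyP; split; last by apply/negP; rewrite -ltNge; nra.
split=> // i j; rewrite ord1 {i} /ball/= !mxE opprD addNKr normrN normrM (gtr0_norm t0).
have := coord_le_enorm (x - c) j; rewrite !mxE => h2.
apply: (@le_lt_trans _ _ (t * (1 + enorm (x - c)))).
  by rewrite ler_pM2l//; lra.
rewrite /t invfM mulrA divfK ?gt_eqF//; lra.
Qed.

End EuclideanNorm.

(** * Coverings by unit balls *)

Section Covering.
Context {R : realType}.

Definition ball_cover d (X : seq 'rV[R]_d) (C : set 'rV[R]_d) :=
  forall x, C x -> exists2 p, p \in X & edist x p < 1.

(** The centers form a grid of mesh [1 / (d + 1)]; rounding all coordinates down moves a point by at
    most [d / (d + 1) < 1]. *)
Lemma bounded_ball_cover d (C : set 'rV[R]_d) :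
  bounded_set C -> exists X, ball_cover X C.
Proof.
move=> /bounded_rowP[M hM].
pose K : R := d.+1%:R.
have K0 : 0 < K by rewrite ltr0n.
pose N := (Num.truncn (K * (M + M))).+1.
pose f (k : {ffun 'I_d -> 'I_N}) : 'rV[R]_d := \row_i ((k i)%:R / K - M).
exists [seq f k | k : {ffun 'I_d -> 'I_N}] => x Cx.
have xM i : 0 <= K * (x ord0 i + M).
  have := hM x Cx i; rewrite ler_norml => /andP[h _].
  by apply: mulr_ge0; [exact: ltW | lra].
have xN i : (Num.truncn (K * (x ord0 i + M)) < N)%N.
  rewrite ltnS; apply: le_truncn; rewrite ler_pM2l// lerD2r.
  by have := hM x Cx i; rewrite ler_norml => /andP[].
pose k := [ffun i => Ordinal (xN i)].
exists (f k); first by rewrite map_f// mem_enum.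
apply: le_lt_trans (enorm_le_coord (e := K^-1) _ _) _ => [|i|].
- by rewrite invr_ge0 ltW.
- rewrite !mxE ffunE /=.
  have /andP[t1 t2] := truncn_itv (xM i).
  rewrite -(ler_pM2l K0) -[X in X * `|_|]gtr0_norm// -normrM mulfV ?gt_eqF//.
  have -> : K * (x ord0 i - ((Num.truncn (K * (x ord0 i + M)))%:R / K - M))
         = K * (x ord0 i + M) - (Num.truncn (K * (x ord0 i + M)))%:R.
    by field; rewrite gt_eqF.
  by rewrite ler_norml; rewrite -natr1 in t2; apply/andP; split; lra.
- by rewrite -/K ltr_pdivrMr// mul1r ltr_nat.
Qed.

Lemma counting_seq d (X : seq 'rV[R]_d) :
  counting [set` X] = ((size (undup X))%:R)%:E :> \bar R.
Proof.
rewrite /counting asboolT; last exact: finite_seq.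
congr (_%:R%:E).
rewrite (perm_size (s2 := undup X))//.
apply: uniq_perm => [||x]; rewrite ?undup_uniq ?finmap.fset_uniq//.
by rewrite mem_undup in_fset_set ?mem_setE//; exact: finite_seq.
Qed.

(** Sizes of finite coverings are natural numbers, so the infimum is a minimum; from here on
    coverings are finite lists. *)
Lemma cov_attained d (C : set 'rV[R]_d) : bounded_set C ->
  exists X, [/\ uniq X, ball_cover X C & (size X)%:R = cov C] /\
  forall Y, ball_cover Y C -> (size X <= size Y)%N.
Proof.
move=> bC.
pose P n := `[< exists2 X, ball_cover X C & size X = n >].
have exP : exists n, P n.
  by have [X XC] := bounded_ball_cover bC; exists (size X); apply/asboolP; exists X.
case: (ex_minnP exP) => n /asboolP[X XC Xn] min.
have minY Y : ball_cover Y C -> (size X <= size Y)%N.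
  by move=> YC; rewrite Xn min//; apply/asboolP; exists Y.
have Xuniq : uniq X.
  have : ball_cover (undup X) C.
    by move=> x Cx; have [p pX xp] := XC x Cx; exists p => //; rewrite mem_undup.
  by move=> /minY; rewrite leqNgt ltn_size_undup negbK.
exists X; split; [split=> //|exact: minY].
rewrite /cov -[LHS]/(fine ((size X)%:R)%:E); congr fine; apply/eqP.
rewrite eq_le; apply/andP; split.
  apply: le_ereal_inf_tmp => _ [Y /= CY <-].
  have [fY|iY] := pselect (finite_set Y); last by rewrite /counting asboolF// leey.
  have /finite_seqP[s Ys] := fY; rewrite Ys counting_seq lee_fin ler_nat.
  apply: minY => x Cx; have /enbhdP [y Yy xy] := CY x Cx.
  by exists y => //; rewrite mem_undup; move: Yy; rewrite Ys.
apply: ereal_inf_lbound; exists [set` X] => /=.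
  by move=> x Cx; have [p pX xp] := XC x Cx; apply/enbhdP; exists p.
by rewrite counting_seq undup_id.
Qed.

Lemma cov_le d (C : set 'rV[R]_d) (X : seq 'rV[R]_d) :
  ball_cover X C -> cov C <= (size X)%:R.
Proof.
move=> XC.
have bC : bounded_set C.
  apply/bounded_set_enorm; exists (1 + \sum_(p <- X) enorm p) => x /XC [p pX xp].
  rewrite -[x](subrK p) (le_trans (enormD _ _))// lerD ?(ltW xp)//.
  by rewrite (big_rem p)//= lerDl sumr_ge0// => *; apply: enorm_ge0.
by have [Y [[_ _ <-] minY]] := cov_attained bC; rewrite ler_nat minY.
Qed.

Lemma cov_ge0 d (C : set 'rV[R]_d) : bounded_set C -> 0 <= cov C.
Proof. by move=> /cov_attained[X [[_ _ <-]]]. Qed.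

Lemma cov_sphere d (C : set 'rV[R]_d) c :
  C !=set0 -> C `<=` (closed_eball c 1)° -> cov C = 1.
Proof.
move=> [x Cx]; rewrite interior_closed_eball => Cc.
have bC : bounded_set C by apply: (@bounded_eball _ _ _ c 1) => y /Cc /ltW.
apply/eqP; rewrite eq_le; apply/andP; split.
  apply: (@cov_le _ C [:: c]) => y /Cc cy; exists c; rewrite ?mem_head//.
  by rewrite edistC.
have [X [[_ XC <-] _]] := cov_attained bC; rewrite ler1n.
by have [p + _] := XC _ Cx; case: X {XC}.
Qed.

Lemma cov_union d (C C' : set 'rV[R]_d) : bounded_set C -> bounded_set C' ->
  (2%:E <= set_edist C C')%E -> cov (C `|` C') = cov C + cov C'.
Proof.
move=> bC bC' /set_edist_ge CC'.
apply/eqP; rewrite eq_le; apply/andP; split.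
  have [X [[_ XC <-] _]] := cov_attained bC.
  have [X' [[_ XC' <-] _]] := cov_attained bC'.
  rewrite -natrD -size_cat; apply: cov_le => x [/XC|/XC'] [p pX xp];
    by exists p; rewrite ?mem_cat ?pX ?orbT.
have bCC' : bounded_set (C `|` C').
  move: bC bC' => /bounded_set_enorm[M hM] /bounded_set_enorm[M' hM'].
  apply/bounded_set_enorm; exists (Num.max M M') => x [/hM|/hM'] h;
    by rewrite le_max h ?orbT.
have [X [[_ XC <-] _]] := cov_attained bCC'.
(* An open unit ball cannot meet two sets at distance at least 2, so an optimal covering splits into
   the balls that touch [C] and the others. *)
pose touches p := `[< exists2 x, C x & edist x p < 1 >].
rewrite -(count_predC touches) natrD -!size_filter lerD//; apply: cov_le => x Cx.
  have [p pX xp] := XC x (or_introl Cx).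
  by exists p => //; rewrite mem_filter pX andbT; apply/asboolP; exists x.
have [p pX xp] := XC x (or_intror Cx).
exists p => //; rewrite mem_filter pX andbT /=; apply/asboolP => -[y Cy yp].
have := CC' y x Cy Cx; have := edist_triangle p y x; rewrite (edistC p x); lra.
Qed.

(** Balls of radius [1 + e] about the centers of a covering of [C'] cover [C]; scaling turns them
    into unit balls. *)
Lemma cov_mesh d (C C' : set 'rV[R]_d) e : bounded_set C' -> 0 < e ->
  C `<=` enbhd C' e -> cov (set_scale (1 + e)^-1 C) <= cov C'.
Proof.
move=> bC' e0 CC'.
have [X [[_ XC <-] _]] := cov_attained bC'.
have e1 : 0 < 1 + e by lra.
rewrite -(size_map (fun p => (1 + e)^-1 *: p)); apply: cov_le => _ [x Cx <-].
have /enbhdP[y C'y xy] := CC' x Cx; have [p pX yp] := XC y C'y.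
exists ((1 + e)^-1 *: p); first exact: map_f.
rewrite edistZ gtr0_norm ?invr_gt0// mulrC ltr_pdivrMr// mul1r.
by have := edist_triangle y x p; lra.
Qed.

End Covering.

(** * Kirszbraun's theorem for one additional point *)

Section WeightedSums.
Context {R : realType}.

Lemma edot_suml n T (l : seq T) (v : T -> 'rV[R]_n) y :
  edot (\sum_(p <- l) v p) y = \sum_(p <- l) edot (v p) y.
Proof.
elim: l => [|p l IH]; first by rewrite !big_nil edot0l.
by rewrite !big_cons edotDl IH.
Qed.

(** A list of weights and points stands for a discrete measure. For total mass 1 both sides are
    twice the variance, which is thus a function of the pairwise distances. *)
Lemma sum_sqr_diff n T (l : seq (R * T)) (v : T -> 'rV[R]_n) :
  \sum_(p <- l) \sum_(q <- l) p.1 * q.1 * edot (v p.2 - v q.2) (v p.2 - v q.2) =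
  2 * ((\sum_(p <- l) p.1) * (\sum_(p <- l) p.1 * edot (v p.2) (v p.2)) -
       edot (\sum_(p <- l) p.1 *: v p.2) (\sum_(p <- l) p.1 *: v p.2)).
Proof.
have -> : edot (\sum_(p <- l) p.1 *: v p.2) (\sum_(p <- l) p.1 *: v p.2) =
    \sum_(p <- l) \sum_(q <- l) p.1 * q.1 * edot (v p.2) (v q.2).
  rewrite edot_suml; apply: eq_bigr => p _; rewrite edotC edot_suml.
  by apply: eq_bigr => q _; rewrite !edotE edotC mulrCA mulrA.
have e1 : (\sum_(p <- l) p.1) * (\sum_(p <- l) p.1 * edot (v p.2) (v p.2)) =
    \sum_(p <- l) \sum_(q <- l) p.1 * (q.1 * edot (v q.2) (v q.2)).
  by rewrite big_distrlr.
have e2 : (\sum_(p <- l) p.1) * (\sum_(p <- l) p.1 * edot (v p.2) (v p.2)) =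
    \sum_(p <- l) \sum_(q <- l) q.1 * (p.1 * edot (v p.2) (v p.2)).
  by rewrite e1 exchange_big.
rewrite mulrBr mulr_natl mulr2n [X in X + _ - _]e1 e2.
rewrite -big_split/= mulr_sumr. rewrite -sumrB; apply: eq_bigr => p _.
rewrite -big_split/= [X in _ - X]mulr_sumr -sumrB; apply: eq_bigr => q _.
rewrite !edotE (edotC (v q.2) (v p.2)); ring.
Qed.

End WeightedSums.

Section Kirszbraun.
Context {R : realType} {d d' : nat}.
Variables (S : set 'rV[R]_d) (f : 'rV[R]_d -> 'rV[R]_d') (z : 'rV[R]_d').
Hypothesis f_expanding : distance_increasing S f.

Let weights (l : seq (R * 'rV[R]_d)) :=
  (forall p, p \in l -> 0 <= p.1 /\ S p.2) /\ \sum_(p <- l) p.1 = 1.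

Let barycenter (l : seq (R * 'rV[R]_d)) := \sum_(p <- l) p.1 *: p.2.

Let power x : R := edot x x - edot (f x - z) (f x - z).

(** For a probability measure [l] this is the minimum over [y] of the mean of
    [|x - y|^2 - |f x - z|^2], attained at the barycenter. It is dual to the search for a [y] making
    all these differences nonpositive. *)
Let value l := \sum_(p <- l) p.1 * power p.2 - edot (barycenter l) (barycenter l).

(** [f] does not decrease pairwise distances, hence not the variance, and the variance of the images
    is at most their second moment about [z]. *)
Let value_le0 l : weights l -> value l <= 0.
Proof.
move=> [Sl l1].
have := sum_sqr_diff l id; have := sum_sqr_diff l (fun x => f x - z).
rewrite l1 !mul1r => e1 e2.
have : \sum_(p <- l) \sum_(q <- l) p.1 * q.1 * edot (p.2 - q.2) (p.2 - q.2) <=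
    \sum_(p <- l) \sum_(q <- l)
      p.1 * q.1 * edot (f p.2 - z - (f q.2 - z)) (f p.2 - z - (f q.2 - z)).
  rewrite !big_seq; apply: ler_sum => p /Sl[p0 Sp].
  rewrite !big_seq; apply: ler_sum => q /Sl[q0 Sq].
  rewrite ler_wpM2l ?mulr_ge0// opprB addrA subrK.
  by rewrite -!sqr_enorm ler_sqr ?nnegrE ?enorm_ge0//; exact: f_expanding.
rewrite e1 e2 ler_pM2l// => h.
rewrite /value /power; under eq_bigr do rewrite mulrBr.
rewrite sumrB /barycenter; move: h.
have := edot_ge0 (\sum_(p <- l) p.1 *: (f p.2 - z)); lra.
Qed.

Let mix t (l1 l2 : seq (R * 'rV[R]_d)) :=
  [seq ((1 - t) * p.1, p.2) | p <- l1] ++ [seq (t * p.1, p.2) | p <- l2].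

Let weights_mix t l1 l2 : 0 <= t <= 1 -> weights l1 -> weights l2 ->
  weights (mix t l1 l2).
Proof.
move=> /andP[t0 t1] [S1 e1] [S2 e2]; split=> [p|].
  rewrite mem_cat => /orP[] /mapP[q ql ->] /=.
    by have [? ?] := S1 _ ql; split=> //; apply: mulr_ge0 => //; lra.
  by have [? ?] := S2 _ ql; split=> //; apply: mulr_ge0.
by rewrite big_cat !big_map/= -!mulr_sumr e1 e2; lra.
Qed.

Let barycenter_mix t l1 l2 :
  barycenter (mix t l1 l2) = (1 - t) *: barycenter l1 + t *: barycenter l2.
Proof.
rewrite /barycenter big_cat !big_map/= !scaler_sumr.
by congr (_ + _); apply: eq_bigr => p _; rewrite scalerA.
Qed.

(** A linear term minus the square of the barycenter is concave with an explicit quadratic defect.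
    [t = 1/2] will give the Cauchy estimate, small [t] the first-order condition. *)
Let value_mix t l1 l2 : value (mix t l1 l2) =
  (1 - t) * value l1 + t * value l2 +
  t * (1 - t) * edot (barycenter l1 - barycenter l2) (barycenter l1 - barycenter l2).
Proof.
rewrite /value barycenter_mix big_cat !big_map/=.
under eq_bigr do rewrite -mulrA; rewrite -mulr_sumr.
under [X in _ + X - _]eq_bigr do rewrite -mulrA; rewrite -mulr_sumr.
rewrite !edotE (edotC (barycenter l2) (barycenter l1)); ring.
Qed.

(* The center y maximizes the concave function [value] on finitely supported
   probability measures on S; the first-order condition at the maximum says
   that y is within [edist z (f x)] of each x. As the supremum need not be
   attained, y is taken as the limit of the barycenters of a maximizing
   sequence, which is Cauchy by strict concavity. *)
Lemma kirszbraun_point : exists y, forall x, S x -> edist y x <= edist z (f x).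
Proof.
have [[x0 Sx0]|S0] := pselect (S !=set0); last first.
  by exists 0 => x Sx; case: S0; exists x.
have weights1 x : S x -> weights [:: (1, x)].
  move=> Sx; split; last by rewrite big_seq1.
  by move=> p; rewrite mem_seq1 => /eqP ->.
have barycenter1 x : barycenter [:: (1, x)] = x.
  by rewrite /barycenter big_seq1 scale1r.
have value1 x : value [:: (1, x)] = - edist z (f x) ^+ 2.
  rewrite /value barycenter1 big_seq1 mul1r /power edistC sqr_enorm; lra.
pose V := [set value l | l in weights].
have supV : has_sup V.
  split; first by exists (value [:: (1, x0)]); exists [:: (1, x0)] => //; exact: weights1.
  by exists 0 => _ [l /value_le0 ? <-].
pose M := sup V.
have leM l : weights l -> value l <= M.
  by move=> wl; apply: sup_ubound; [case: supV|exists l].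
have M0 : M <= 0.
  by apply: ge_sup; [case: supV|move=> _ [l /value_le0 ? <-]].
have /choice[l hl] : forall n : nat, exists l, weights l /\ M - n.+1%:R^-1 < value l.
  move=> n; have [|_ [l wl <-] h] := @sup_adherent _ V n.+1%:R^-1 _ supV.
    by rewrite invr_gt0.
  by exists l.
pose y n := barycenter (l n).
(* The midpoint of two nearly optimal measures has value at most [M], which forces their barycenters
   to be close. *)
have y_dist n m : edist (y n) (y m) ^+ 2 <= 2 * (n.+1%:R^-1 + m.+1%:R^-1).
  have [wn vn] := hl n; have [wm vm] := hl m.
  have /leM : weights (mix 2^-1 (l n) (l m)) by apply: weights_mix => //; lra.
  rewrite value_mix sqr_enorm -/(y n) -/(y m).
  move: (value _) (value _) (edot _ _) (M) n.+1%:R^-1 m.+1%:R^-1 vn vm.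
  by move=> a b E M' u v; lra.
have cvg_coord i : cvgn (fun n => y n ord0 i).
  apply/cauchy_cvgP/cauchy_exP => e /= e0.
  pose N := Num.truncn (4 / e ^+ 2).
  have hN : 4 / e ^+ 2 < N.+1%:R by exact: truncnS_gt.
  have e2 : 4 * N.+1%:R^-1 < e ^+ 2.
    by rewrite ltr_pdivrMr// mulrC -ltr_pdivrMr// exprn_gt0.
  exists (y N ord0 i); exists N => // n /= Nn.
  rewrite /ball/= -ltr_sqr ?nnegrE ?(ltW e0)//; apply: le_lt_trans e2.
  apply: le_trans (_ : edist (y N) (y n) ^+ 2 <= _).
    have := coord_le_enorm (y N - y n) i; rewrite !mxE => h.
    by rewrite ler_sqr ?nnegrE ?edist_ge0.
  apply: le_trans (y_dist _ _) _.
  have : n.+1%:R^-1 <= N.+1%:R^-1 :> R by rewrite lef_pV2 ?posrE// ler_nat ltnS.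
  by move: n.+1%:R^-1 N.+1%:R^-1 => u v; lra.
pose y0 : 'rV[R]_d := \row_i limn (fun n => y n ord0 i).
exists y0 => x Sx.
have cvg_dist : (fun n => edot (y n - x) (y n - x)) @ \oo --> edot (y0 - x) (y0 - x).
  apply: cvg_big => [|i _]; first exact: add_continuous.
  rewrite !mxE.
  under eq_fun do rewrite !mxE.
  by apply: cvgM; apply: cvgB (cvg_coord i) (cvg_cst _).
(* Mixing a nearly optimal measure with mass [t] at [x] gives a value of at most [M], where
   [M <= 0]; let [n] tend to infinity and divide by [t]. *)
have main t : 0 < t < 1 -> (1 - t) * edot (y0 - x) (y0 - x) <= edist z (f x) ^+ 2.
  move=> /andP[t0 t1].
  have : (fun n => t * (1 - t) * edot (y n - x) (y n - x) - harmonic n) @ \oo -->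
         t * (1 - t) * edot (y0 - x) (y0 - x) - 0.
    by apply: cvgB; [apply: cvgMl_tmp|exact: cvg_harmonic].
  move=> /[dup] /cvg_lim => /(_ (@Rhausdorff _)) e c.
  have cv : cvgn (fun n => t * (1 - t) * edot (y n - x) (y n - x) - harmonic n).
    by apply/cvg_ex; eexists; exact: c.
  have := limr_le (x := t * edist z (f x) ^+ 2) cv.
  rewrite e subr0 => /(_ _) h; rewrite -(ler_pM2l t0) mulrA; apply: h.
  apply: nearW => n.
  have [wn vn] := hl n.
  have /leM : weights (mix t (l n) [:: (1, x)]).
    by apply: weights_mix => //; [lra|exact: weights1].
  rewrite value_mix value1 barycenter1 -/(y n) /harmonic/=.
  have : 0 < n.+1%:R^-1 :> R by rewrite invr_gt0.
  move: (value _) (edot _ _) (M) (edist _ _ ^+ 2) n.+1%:R^-1 vn M0.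
  by move=> v E M' r u; nra.
rewrite -ler_sqr ?nnegrE ?edist_ge0// [leLHS]sqr_enorm.
rewrite leNgt; apply/negP => lt.
set D := edot _ _ in main lt; set r := _ ^+ 2 in main lt.
have r0 : 0 <= r by rewrite sqr_ge0.
have D0 : 0 < D by exact: le_lt_trans lt.
(* For this [t], [(1 - t) * D] is the mean of [D] and [r], which exceeds [r]. *)
have := main ((D - r) / (2 * D)).
have e : (1 - (D - r) / (2 * D)) * D = (D + r) / 2 by field; rewrite gt_eqF.
rewrite e; have t0 : 0 < (D - r) / (2 * D) by rewrite divr_gt0//; lra.
have t1 : (D - r) / (2 * D) < 1 by rewrite ltr_pdivrMr; lra.
by rewrite t0 t1 => /(_ isT); lra.
Qed.

End Kirszbraun.

(** The points of [C] sent into the ball about [z] lie in the ball about [g z]. Kirszbraun's bound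
    holds point by point, so strict inequalities survive and the new balls are open. *)
Lemma cov_lipschitz (R : realType) d d' (C : set 'rV[R]_d) (C' : set 'rV[R]_d') f :
  bounded_set C' -> {homo f : x / C x >-> C' x} -> distance_increasing C f ->
  cov C <= cov C'.
Proof.
move=> bC' fC fdi.
have [X [[_ XC <-] _]] := cov_attained bC'.
have /choice[g hg] : forall z, exists y, forall x, C x -> edist z (f x) < 1 -> edist y x < 1.
  move=> z.
  have [|y hy] := @kirszbraun_point _ _ _ [set x | C x /\ edist z (f x) < 1] f z.
    by move=> x y [Cx _] [Cy _]; exact: fdi.
  by exists y => x Cx fx; apply: le_lt_trans (hy x (conj Cx fx)) fx.
rewrite -(size_map g); apply: cov_le => x Cx.
have [p pX xp] := XC _ (fC x Cx).
by exists (g p); [exact: map_f|rewrite edistC; apply: hg => //; rewrite edistC].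
Qed.

(** * Maximality *)

Section Maximality.
Context {R : realType}.

Lemma cov_packing_bound_function : packing_bound_function (@cov R).
Proof.
split.
- by move=> d C [bC _]; exact: cov_ge0.
- by move=> d C _ C0 [c]; exact: cov_sphere.
- by move=> d d' C C' _ [bC' _] [psi [fC di]]; exact: cov_lipschitz bC' fC di.
- by move=> d C C' [bC _] [bC' _]; exact: cov_union.
- by move=> d C C' e _ [bC' _]; exact: cov_mesh.
Qed.

Lemma open_bounded_borel d (C : set 'rV[R]_d) :
  bounded_set C -> open C -> bounded_borel C.
Proof. by move=> bC oC; split=> //; exact: sub_sigma_algebra. Qed.

(** * Lifting to one more dimension, and towers of balls *)

Definition lift_row d (t : R) (x : 'rV[R]_d) : 'rV[R]_d.+1 := row_mx t%:M x.

Lemma lift_row0 d t (x : 'rV[R]_d) : lift_row t x ord0 ord0 = t.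
Proof.
rewrite /lift_row mxE; case: splitP => [j _|k]; last by [].
by rewrite !mxE (ord1 j).
Qed.

Lemma lift_rowS d t (x : 'rV[R]_d) i : lift_row t x ord0 (lift ord0 i) = x ord0 i.
Proof.
rewrite /lift_row mxE; case: splitP => [j|k]; first by rewrite ord1.
by move=> /eqP; rewrite eqSS => /eqP /val_inj ->.
Qed.

Lemma lift_rowB d s t (x y : 'rV[R]_d) :
  lift_row s x - lift_row t y = lift_row (s - t) (x - y).
Proof.
apply/rowP => i; rewrite [LHS]mxE [X in _ + X]mxE.
case: (unliftP ord0 i) => [j ->|->]; last by rewrite !lift_row0.
by rewrite !lift_rowS !mxE.
Qed.

Lemma edist_lift_row d s t (x y : 'rV[R]_d) :
  edist (lift_row s x) (lift_row t y) ^+ 2 = (s - t) ^+ 2 + edist x y ^+ 2.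
Proof.
rewrite /edist lift_rowB !sqr_enorm /edot big_ord_recl !lift_row0 -expr2; congr (_ + _).
by apply: eq_bigr => i _; rewrite lift_rowS.
Qed.

Lemma edist_lift_row_same d t (x y : 'rV[R]_d) :
  edist (lift_row t x) (lift_row t y) = edist x y.
Proof.
apply/eqP; rewrite -(eqrXn2 (n := 2)) ?edist_ge0//.
by rewrite edist_lift_row subrr expr0n add0r.
Qed.

(** Centers on different floors differ by at least 4 in height, so the balls are at least 2 apart
    whatever the horizontal positions [f]. *)
Definition ball_tower d (f : nat -> 'rV[R]_d) n : set 'rV[R]_d.+1 :=
  [set x | exists2 i, (i < n)%N & edist (lift_row (4 * i%:R) (f i)) x < 1].

Lemma ball_tower_bounded_borel d (f : nat -> 'rV[R]_d) n :
  bounded_borel (ball_tower f n).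
Proof.
apply: open_bounded_borel.
  apply/bounded_set_enorm.
  exists (1 + \sum_(i < n) enorm (lift_row (4 * i%:R) (f i))) => x [i lt_in ix].
  rewrite -[x](subrK (lift_row (4 * i%:R) (f i))) (le_trans (enormD _ _))//.
  apply: lerD; first by move: ix; rewrite edistC => /ltW.
  rewrite (bigD1 (Ordinal lt_in))//= lerDl sumr_ge0// => *; exact: enorm_ge0.
have -> : ball_tower f n = \bigcup_(i in [set i | (i < n)%N])
    [set x | edist (lift_row (4 * i%:R) (f i)) x < 1].
  by apply/seteqP; split=> x [i]; exists i.
by apply: bigcup_open => i _; exact: open_eball.
Qed.

(** The empty set is at infinite distance from itself, so its value equals twice itself by the union
    axiom. *)
Lemma pbf_set0 (A : borel_set_function R) d : packing_bound_function A ->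
  A d set0 = 0.
Proof.
move=> pA; have b0 : bounded_borel (@set0 'rV[R]_d).
  by apply: open_bounded_borel open0; apply/bounded_set_enorm; exists 0.
have := pbf_union pA b0 b0; rewrite setU0 => /(_ _) h.
have /h : (2%:E <= set_edist (@set0 'rV[R]_d) set0)%E by apply/set_edist_ge.
lra.
Qed.

Lemma pbf_ball_tower (A : borel_set_function R) d (f : nat -> 'rV[R]_d) n :
  packing_bound_function A -> A _ (ball_tower f n) = n%:R.
Proof.
move=> pA; elim: n => [|n IH].
  have -> : ball_tower f 0 = set0 by apply/seteqP; split=> x // [].
  exact: pbf_set0.
pose B := [set x | edist (lift_row (4 * n%:R) (f n)) x < 1].
have BT : ball_tower f n.+1 = ball_tower f n `|` B.
  apply/seteqP; split=> x [].
  - move=> i; rewrite ltnS leq_eqVlt => /orP[/eqP ->|lt_in] ix; first by right.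
    by left; exists i.
  - by move=> [i lt_in ix]; exists i => //; exact: ltnW.
  - by move=> nx; exists n.
have bB : bounded_borel B.
  apply: open_bounded_borel; last exact: open_eball.
  by apply: (@bounded_eball _ _ _ (lift_row (4 * n%:R) (f n)) 1) => x /ltW.
rewrite BT (pbf_union pA)//; [|exact: ball_tower_bounded_borel|].
  rewrite IH -natr1; congr (_ + _); apply: (pbf_sphere pA) => //.
    by exists (lift_row (4 * n%:R) (f n)); rewrite /B/= edistxx.
  by exists (lift_row (4 * n%:R) (f n)); rewrite interior_closed_eball.
apply/set_edist_ge => x y [i lt_in ix] ny.
have := coord_le_enorm (lift_row (4 * n%:R) (f n) - lift_row (4 * i%:R) (f i)) ord0.
rewrite lift_rowB lift_row0 -lift_rowB -/(edist _ _) => h.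
have lt_in' : (i%:R + 1 <= n%:R :> R) by rewrite natr1 ler_nat.
have := ler_norm (4 * n%:R - 4 * i%:R : R).
have := edist_triangle y (lift_row (4 * n%:R) (f n)) (lift_row (4 * i%:R) (f i)).
have := edist_triangle x y (lift_row (4 * i%:R) (f i)).
rewrite (edistC y x) (edistC x (lift_row _ _)); move: ny; rewrite /B/=; lra.
Qed.

Lemma pbf_le_cov (A : borel_set_function R) : packing_bound_function A ->
  forall d (C : set 'rV[R]_d), bounded_borel C -> A d C <= cov C.
Proof.
move=> pA d C bC; have [X [[_ XC <-] _]] := cov_attained bC.1.
rewrite -(pbf_ball_tower (nth 0 X) (size X) pA).
apply: (pbf_lipschitz pA) => //; first exact: ball_tower_bounded_borel.
(* Each point of [C] goes to the floor of the first ball containing it, straight above its old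
   position; height differences only add to distances. *)
pose i x := find (fun p => edist x p < 1) X.
exists (fun x => lift_row (4 * (i x)%:R) x); split=> [x /XC [p pX xp]|x y _ _].
  have hasX : has (fun p => edist x p < 1) X by apply/hasP; exists p.
  exists (i x); first by rewrite -has_find.
  by rewrite edist_lift_row_same edistC; exact: (nth_find 0 hasX).
by rewrite -ler_sqr ?nnegrE ?edist_ge0// edist_lift_row lerDr sqr_ge0.
Qed.

End Maximality.

(** * Squares of a planar lattice *)

Section LatticeSquares.
Context {R : realType}.
Variable s : R.
Hypothesis s0 : 0 < s.

(** Half-open, so that lattice squares are disjoint and the indicator of a union is a sum. *)
Definition lattice_itv (i : nat) : set R := [set` `[i%:R * s, i.+1%:R * s[ ].

Definition lattice_squares (D : seq (nat * nat)) : set 'rV[R]_2 :=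
  [set x | exists2 p, p \in D &
    lattice_itv p.1 (x ord0 ord0) /\ lattice_itv p.2 (x ord0 (lift ord0 ord0))].

Lemma lattice_itv_inj i j x : lattice_itv i x -> lattice_itv j x -> i = j.
Proof.
have le_of k l : lattice_itv k x -> lattice_itv l x -> (k <= l)%N.
  rewrite /lattice_itv/= !in_itv/= => /andP[kx _] /andP[_ xl].
  by have := le_lt_trans kx xl; rewrite ltr_pM2r// ltr_nat ltnS.
by move=> ix jx; apply/eqP; rewrite eqn_leq !le_of.
Qed.

Lemma measure_lattice_itv i : lebesgue_measure (lattice_itv i) = s%:E.
Proof.
rewrite lebesgue_measure_itv/= lte_fin ltr_pM2r// ltr_nat ltnSn -EFinD.
by rewrite -mulrBl -natr1 addrAC subrr add0r mul1r.
Qed.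

Lemma indic_lattice_squares D (x : 'rV[R]_2) : uniq D ->
  \1_(lattice_squares D) x = \sum_(p <- D)
    \1_(lattice_itv p.1) (x ord0 ord0) *
    \1_(lattice_itv p.2) (x ord0 (lift ord0 ord0)) :> R.
Proof.
move=> uD; have [[p pD [p1 p2]]|nx] := pselect (lattice_squares D x).
  rewrite (bigD1_seq p)//= big1 => [|q qp].
    rewrite !indicE !mem_set// ?mulr1 ?addr0//.
    by exists p.
  rewrite !indicE -natrM mulnb; apply/eqP; rewrite pnatr_eq0 eqb0.
  apply/negP => /andP[/set_mem q1 /set_mem q2]; move/eqP: qp; apply.
  by rewrite (surjective_pairing p) (surjective_pairing q)
    (lattice_itv_inj p1 q1) (lattice_itv_inj p2 q2).
rewrite indicE memNset// big_seq big1// => p pD.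
rewrite !indicE -natrM mulnb; apply/eqP; rewrite pnatr_eq0 eqb0.
by apply/negP => /andP[/set_mem q1 /set_mem q2]; apply: nx; exists p.
Qed.

Lemma measurable_indic_lattice i :
  measurable_fun setT (\1_(lattice_itv i) : R -> R).
Proof. by apply: measurable_indic; exact: measurable_itv. Qed.

Lemma integral_indic_lattice i :
  (\int[@lebesgue_measure R]_t (\1_(lattice_itv i) t)%:E = s%:E)%E.
Proof.
rewrite integral_indic//; last exact: measurable_itv.
by rewrite setIT; exact: measure_lattice_itv.
Qed.

Lemma lebesgue_lattice_squares D : uniq D ->
  lebesgue_measure_rV (lattice_squares D) = ((size D)%:R * s ^+ 2)%:E.
Proof.
move=> uD; rewrite /lebesgue_measure_rV.
transitivity (\int[@lebesgue_measure R]_t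
    \sum_(p <- D) ((\1_(lattice_itv p.1) t : R)%:E * s%:E))%E.
  apply: eq_integral => t _.
  transitivity (\int[@lebesgue_measure R]_u \sum_(p <- D)
      ((\1_(lattice_itv p.1) t)%:E * (\1_(lattice_itv p.2) u)%:E))%E.
    apply: eq_integral => u _.
    (* The recursion ends in dimension 0, with the indicator at the point 0. *)
    rewrite (_ : \1__ _ = \1_(lattice_squares D) (lift_row t (lift_row u 0))).
      rewrite indic_lattice_squares// -sumEFin; apply: eq_bigr => p _.
      by rewrite lift_rowS !lift_row0 EFinM.
    by rewrite !indicE; congr (_%:R); apply/idP/idP => /set_mem h; apply/mem_set.
  rewrite ge0_integral_sum//.
  - apply: eq_bigr => p _; rewrite ge0_integralZl//.
    + by rewrite integral_indic_lattice.
    + apply/measurable_EFinP; exact: measurable_indic_lattice.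
  - by move=> p; apply: measurable_funeM; apply/measurable_EFinP; exact: measurable_indic_lattice.
rewrite ge0_integral_sum//; last first.
- by move=> p t _; rewrite mule_ge0// lee_fin// ltW.
- move=> p; under eq_fun do rewrite muleC.
  by apply: measurable_funeM; apply/measurable_EFinP; exact: measurable_indic_lattice.
rewrite (eq_bigr (fun=> (s * s)%:E)) => [|p _].
  by rewrite sumEFin big_const_seq count_predT iter_addr_0 expr2 mulr_natl.
rewrite ge0_integralZr//.
- by rewrite integral_indic_lattice.
- by apply/measurable_EFinP; exact: measurable_indic_lattice.
- by rewrite lee_fin ltW.
Qed.

End LatticeSquares.

(** * Overlaps in planar coverings *)

Section PlaneVectors.
Context {R : realType}.

Definition vec2 (a b : R) : 'rV[R]_2 := \row_i (if i == ord0 then a else b).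

Definition ord1_2 : 'I_2 := lift ord0 ord0.

Lemma ord2P (P : 'I_2 -> Prop) : P ord0 -> P ord1_2 -> forall i, P i.
Proof. by move=> P0 P1 i; case: (unliftP ord0 i) => [j ->|->//]; rewrite (ord1 j). Qed.

Lemma edot2E (x y : 'rV[R]_2) :
  edot x y = x ord0 ord0 * y ord0 ord0 + x ord0 ord1_2 * y ord0 ord1_2.
Proof. by rewrite /edot !big_ord_recl big_ord0 addr0. Qed.

Lemma vec2_0 a b : vec2 a b ord0 ord0 = a.
Proof. by rewrite mxE. Qed.

Lemma vec2_1 a b : vec2 a b ord0 ord1_2 = b.
Proof. by rewrite mxE. Qed.

Lemma edist_vec2 a b (x : 'rV[R]_2) :
  edist (vec2 a b) x ^+ 2 = (a - x ord0 ord0) ^+ 2 + (b - x ord0 ord1_2) ^+ 2.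
Proof. by rewrite sqr_enorm edot2E !mxE /= -!expr2. Qed.

Definition lattice_point (K : nat) (p : nat * nat) : 'rV[R]_2 :=
  vec2 (p.1%:R / K%:R) (p.2%:R / K%:R).

Lemma lattice_squares_borel (s : R) D :
  <<s [set U : set 'rV[R]_2 | open U] >> (lattice_squares s D).
Proof.
have borel_lt i (b : R) : <<s [set U : set 'rV[R]_2 | open U] >> [set x | x ord0 i < b].
  apply: sub_sigma_algebra => /=.
  apply: (@open_comp _ _ (fun x : 'rV[R]_2 => x ord0 i) [set y | y < b]).
    by move=> x _; exact: coord_continuous.
  exact: open_lt.
pose T := g_sigma_algebraType [set U : set 'rV[R]_2 | open U].
have mlt i (b : R) : measurable ([set x | x ord0 i < b] : set T) by exact: borel_lt.
have mitv i j : measurable [set x : T | lattice_itv s j (x ord0 i)].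
  have -> : [set x : T | lattice_itv s j (x ord0 i)] =
      ~` [set x | x ord0 i < j%:R * s] `&` [set x | x ord0 i < j.+1%:R * s].
    apply/seteqP; split=> x; rewrite /lattice_itv/= in_itv/=.
      by move=> /andP[]; rewrite leNgt => /negP.
    by case=> /negP; rewrite -leNgt => -> ->.
  by apply: measurableI => //; apply: measurableC.
suff : measurable (lattice_squares s D : set T) by [].
elim: D => [|p D IH].
  rewrite (_ : lattice_squares s [::] = set0); first exact: measurable0.
  by apply/seteqP; split=> x // [].
rewrite (_ : lattice_squares s (p :: D) =
  ([set x : 'rV[R]_2 | lattice_itv s p.1 (x ord0 ord0)] `&`
   [set x : 'rV[R]_2 | lattice_itv s p.2 (x ord0 ord1_2)]) `|` lattice_squares s D).
  by apply: measurableU => //; apply: measurableI.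
apply/seteqP; split=> x.
  move=> [q]; rewrite in_cons => /orP[/eqP ->|qD] h; first by left.
  by right; exists q.
move=> [h|[q qD h]]; first by exists p; rewrite ?mem_head.
by exists q; rewrite ?in_cons ?qD ?orbT.
Qed.

(* Lattice points in a unit ball give rise to a region of proportional area that
   is covered by a single ball: the squares of side 1 / (K + 2) that they span
   once the plane is shrunk by K / (K + 2). *)
Lemma euclidean_bound_lattice (delta : R) K c (D : seq (nat * nat)) : (0 < K)%N ->
  (forall C : set 'rV[R]_2, bounded_borel C ->
    (delta%:E * lebesgue_measure_rV C <= (cov C)%:E)%E) ->
  uniq D -> {in D, forall p, edist (lattice_point K p) c < 1} ->
  delta * (size D)%:R <= (K%:R + 2) ^+ 2.
Proof.
move=> K0 eb uD Dc.
have K0' : 0 < K%:R :> R by rewrite ltr0n.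
pose s : R := (K%:R + 2)^-1.
have s0 : 0 < s by rewrite invr_gt0 addr_gt0.
have cover : ball_cover [:: (s * K%:R) *: c] (lattice_squares s D).
  move=> x [p pD [xp1 xp2]]; exists ((s * K%:R) *: c); first exact: mem_head.
  apply: le_lt_trans (edist_triangle ((s * K%:R) *: lattice_point K p) _ _) _.
  rewrite edistZ gtr0_norm ?mulr_gt0//.
  have h1 : s * K%:R * edist (lattice_point K p) c < s * K%:R.
    by rewrite gtr_pMr ?mulr_gt0// Dc.
  (* In the shrunk plane the square is within [2 * s] of its lattice point, and the ball has radius
     [s * K]; [s] makes these add up to 1. *)
  have e1 : 2 * s + s * K%:R = 1 by rewrite /s; field; rewrite gt_eqF ?addr_gt0.
  suff : edist x ((s * K%:R) *: lattice_point K p) <= 2 * s by lra.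
  apply: (@enorm_le_coord _ 2); first exact: ltW.
  have coord (n : nat) y : lattice_itv s n y -> `|y - s * K%:R * (n%:R / K%:R)| <= s.
    rewrite /lattice_itv/= in_itv/= => /andP[y1 y2].
    have -> : s * K%:R * (n%:R / K%:R) = n%:R * s by field; rewrite gt_eqF.
    by rewrite ler_norml; rewrite -natr1 mulrDl mul1r in y2; apply/andP; split; lra.
  by apply: ord2P; rewrite !mxE/=; apply: coord.
have bb : bounded_borel (lattice_squares s D).
  split; last exact: lattice_squares_borel.
  apply: (@bounded_eball _ _ _ ((s * K%:R) *: c) 1) => x /cover [p].
  by rewrite mem_seq1 => /eqP -> /ltW; rewrite edistC.
have := eb _ bb; rewrite lebesgue_lattice_squares// -EFinM lee_fin => /le_trans.
move=> /(_ _ (cov_le cover)) h.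
rewrite -[leRHS]mul1r -ler_pdivrMr ?exprn_gt0 ?addr_gt0//.
by move: h; rewrite /s exprVn mulrA.
Qed.

(** With [v = c1 - c], [|u - v| < 1] says [|v|^2 < 2 <u, v>], so [|v - 2 u|^2 < 4 - |v|^2]. For
    [rho] near 2, [c1] is close to the center [c + 2 u] of the ball tangent at [c + u]. *)
Lemma near_antipode d (c c1 u : 'rV[R]_d) (rho : R) : 0 <= rho -> enorm u = 1 ->
  edist (c + u) c1 < 1 -> rho <= edist c c1 ->
  edist c1 (c + 2 *: u) ^+ 2 < 4 - rho ^+ 2.
Proof.
move=> rho0 u1 h1 h2.
have uu : edot u u = 1 by rewrite -sqr_enorm u1 expr1n.
have e1 : c + u - c1 = u - (c1 - c) by rewrite opprB addrCA addrA.
have e2 : c1 - (c + 2 *: u) = (c1 - c) - 2 *: u by rewrite opprD addrA.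
have h3 : rho ^+ 2 <= edot (c1 - c) (c1 - c).
  by rewrite -sqr_enorm -/(edist _ _) edistC ler_sqr ?nnegrE ?edist_ge0.
move: h1; rewrite /edist e1 enorm_lt// e2 sqr_enorm; move: (c1 - c) h3 => v.
by rewrite !edotE uu (edotC v u); lra.
Qed.

(* Two balls of a covering whose centers are closer than 2 overlap in a ball;
   centers that are almost 2 apart would all have to be almost antipodal to any
   boundary point they cover, but two boundary points at distance sqrt (2 / 5)
   do not allow that. *)
Lemma doubly_covered_ball (X : seq 'rV[R]_2) (p : 'rV[R]_2) :
  ball_cover X [set x | forall i, `|x ord0 i - p ord0 i| <= 4] ->
  exists m x1 x2, [/\ x1 \in X, x2 \in X, x1 != x2, edist m p < 3 &
    forall z, edist z m <= 100^-1 -> edist z x1 < 1 /\ edist z x2 < 1].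
Proof.
move=> Xp.
(* The midpoint of two centers less than [2 - 1/50] apart is less than [1 - 1/100] away from
   both. *)
suff [x1 [x2 [x1X x2X x12 [h1 h2 h12]]]] : exists x1 x2, [/\ x1 \in X, x2 \in X,
    x1 != x2 & [/\ edist x1 p < 3, edist x2 p < 3 & edist x1 x2 < 2 - 50^-1]].
  exists (2^-1 *: (x1 + x2)), x1, x2; split=> //.
    have -> : edist (2^-1 *: (x1 + x2)) p = 2^-1 * enorm ((x1 - p) + (x2 - p)).
      rewrite -[2^-1 in RHS]gtr0_norm// -enormZ /edist; congr enorm.
      by apply/rowP => i; rewrite !mxE; field.
    by have := enormD (x1 - p) (x2 - p); move: h1 h2; rewrite /edist; lra.
  have mid (x y z : 'rV[R]_2) : edist x y < 2 - 50^-1 -> edist z (2^-1 *: (x + y)) <= 100^-1 ->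
      edist z x < 1.
    move=> xy zm; apply: le_lt_trans (edist_triangle (2^-1 *: (x + y)) _ _) _.
    have -> : edist (2^-1 *: (x + y)) x = 2^-1 * edist x y.
      rewrite edistC -[2^-1 in RHS]gtr0_norm// -enormZ /edist; congr enorm.
      by apply/rowP => i; rewrite !mxE; field.
    lra.
  move=> z zm; split; first exact: mid zm.
  by have := mid x2 x1 z; rewrite (edistC x2) (addrC x2); apply.
(* [c + u] lies on the boundary of the open ball about [c], so another ball must cover it. *)
have unit_cover c u : edist p c < 1 -> enorm u = 1 ->
    exists2 c1, c1 \in X & [/\ edist (c + u) c1 < 1, edist c1 p < 3 & c != c1].
  move=> pc u1.
  have cu (x : 'rV[R]_2) : edist (x + u) x = 1 by rewrite /edist addrAC subrr add0r.
  have [|c1 c1X h] := Xp (c + u).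
    move=> i; have := coord_le_enorm (c + u - p) i; rewrite !mxE => h.
    apply: le_trans h _; rewrite -/(edist _ _).
    by have := edist_triangle c (c + u) p; rewrite cu (edistC c p); lra.
  exists c1 => //; split=> //.
    have := edist_triangle (c + u) c1 p; have := edist_triangle c (c + u) p.
    by rewrite cu (edistC c p) (edistC c1 (c + u)); lra.
  by apply/eqP => e; move: h; rewrite -e cu ltxx.
have [|c cX pc] := Xp p; first by move=> i; rewrite subrr normr0.
have cp : edist c p < 3 by rewrite edistC; lra.
pose u := vec2 1 0; pose v := vec2 (4 / 5) (3 / 5).
have u1 : enorm u = 1.
  by rewrite enormE edot2E !mxE/= (_ : _ + _ = 1) ?sqrtr1//; ring.
have v1 : enorm v = 1.
  by rewrite enormE edot2E !mxE/= (_ : _ + _ = 1) ?sqrtr1//; field.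
have [c1 c1X [h1 c1p cc1]] := unit_cover c u pc u1.
have [c2 c2X [h2 c2p cc2]] := unit_cover c v pc v1.
have [d1|d1] := ltP (edist c c1) (2 - 50^-1); first by exists c, c1.
have [d2|d2] := ltP (edist c c2) (2 - 50^-1); first by exists c, c2.
have rho0 : 0 <= 2 - 50^-1 :> R by lra.
(* Here [4 - (2 - 1/50)^2 = 0.0796 < 1/9]. *)
have third (x y : 'rV[R]_2) : edist x y ^+ 2 < 4 - (2 - 50^-1) ^+ 2 -> edist x y < 3^-1.
  by move=> h; rewrite -ltr_sqr ?nnegrE ?edist_ge0//; nra.
have {h1}h1 := third _ _ (near_antipode rho0 u1 h1 d1).
have {h2}h2 := third _ _ (near_antipode rho0 v1 h2 d2).
have uv : edist (c + 2 *: u) (c + 2 *: v) ^+ 2 = 8 / 5.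
  by rewrite sqr_enorm edot2E !mxE/=; field.
have uv0 := edist_ge0 (c + 2 *: u) (c + 2 *: v).
have uv1 : edist (c + 2 *: u) (c + 2 *: v) < 127 / 100.
  by rewrite -ltr_sqr ?nnegrE// ?uv; lra.
have uv2 : 1 < edist (c + 2 *: u) (c + 2 *: v).
  by rewrite -ltr_sqr ?nnegrE// ?uv; lra.
(* [c1] and [c2] are within 1/3 of two points whose distance is between 1 and 1.27, so they are
   distinct and less than 1.94 apart. *)
exists c1, c2; split=> //.
  apply/eqP => e; have := edist_triangle c1 (c + 2 *: u) (c + 2 *: v).
  by rewrite (edistC _ c1); move: h2; rewrite -e; lra.
split=> //.
have := edist_triangle (c + 2 *: u) c1 c2.
have := edist_triangle (c + 2 *: v) (c + 2 *: u) c2.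
by rewrite (edistC (c + 2 *: v) c2); lra.
Qed.

End PlaneVectors.

(** * Counting lattice points with multiplicity *)

Section OverlapCount.
Context {R : realType}.

Lemma count_ge2 (T : eqType) (a : pred T) (s : seq T) x y :
  x \in s -> y \in s -> x != y -> a x -> a y -> (2 <= count a s)%N.
Proof.
move=> xs ys xy ax ay; rewrite -size_filter.
rewrite -[2%N]/(size [:: x; y]); apply: uniq_leq_size; first by rewrite /= inE xy.
by move=> z; rewrite !inE => /orP[] /eqP ->; rewrite mem_filter ?ax ?ay.
Qed.

(** The interval of length 1/100 about [y] holds [q] consecutive points of a lattice of mesh
    [1 / (100 q)]; the margins at both ends of [[A, A + 8]] keep their indices in range. *)
Lemma lattice_points_near (A y : R) (q : nat) : (0 < q)%N -> 1 <= y - A <= 7 ->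
  exists i0, (i0 + q <= 8 * (100 * q))%N /\
    forall j, (j < q)%N -> `|A + (i0 + j)%:R / (100 * q)%:R - y| <= 200^-1.
Proof.
move=> q0 /andP[y1 y7].
have Q1 : 1 <= q%:R :> R by rewrite ler1n.
pose Y := 100 * q%:R * (y - A - 200^-1).
have Y0 : 0 <= Y by rewrite /Y; nra.
have /andP[tY Yt] := truncn_itv Y0; rewrite -natr1 in Yt.
exists (Num.truncn Y).+1; split=> [|j jq].
  by rewrite -(ler_nat R) natrD !natrM -natr1; move: tY; rewrite {2}/Y; nra.
have jq' : j%:R + 1 <= q%:R :> R by rewrite natr1 ler_nat.
have j0 : 0 <= j%:R :> R by [].
have K0 : 0 < 100 * q%:R :> R by lra.
rewrite natrD natrM -natr1 ler_norml; set w := _ / _.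
have e : w * (100 * q%:R) = (Num.truncn Y)%:R + 1 + j%:R by rewrite divfK// gt_eqF.
apply/andP; split; rewrite -(ler_pM2r K0); move: tY Yt; rewrite {2 3}/Y; nra.
Qed.

(** All [P * P] lattice points of a square of side 8 are covered, and a [q] by [q] block of them
    lies in a doubly covered ball of radius 1/100. *)
Lemma cell_count (X : seq 'rV[R]_2) (A B : R) (q K P : nat) :
  (0 < q)%N -> K = (100 * q)%N -> P = (8 * K)%N ->
  ball_cover X [set x | A <= x ord0 ord0 <= A + 8 /\ B <= x ord0 ord1_2 <= B + 8] ->
  (P * P + q * q <= \sum_(t : 'I_P * 'I_P)
    count (fun x => (edist (vec2 (A + t.1%:R / K%:R) (B + t.2%:R / K%:R)) x < 1)%R) X)%N.
Proof.
move=> q0 KE PE XC.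
have [|m [x1 [x2 [x1X x2X x12 mp h12]]]] := @doubly_covered_ball _ X (vec2 (A + 4) (B + 4)).
  move=> x xp; apply: XC => /=.
  have := xp ord0; have := xp ord1_2; rewrite vec2_0 vec2_1 !ler_norml.
  by move=> /andP[? ?] /andP[? ?]; split; apply/andP; split; lra.
have := coord_le_enorm (m - vec2 (A + 4) (B + 4)) ord0.
have := coord_le_enorm (m - vec2 (A + 4) (B + 4)) ord1_2.
rewrite !mxE/= !ler_norml => /andP[mB mB'] /andP[mA mA'].
move: mp; rewrite /edist => mp.
have [|i0 [i0P hi]] := @lattice_points_near A (m ord0 ord0) q q0; first by lra.
rewrite -KE -PE in i0P hi.
have [|j0 [j0P hj]] := @lattice_points_near B (m ord0 ord1_2) q q0; first by lra.
rewrite -KE -PE in j0P hj.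
pose z (t : 'I_P * 'I_P) := vec2 (A + t.1%:R / K%:R) (B + t.2%:R / K%:R).
pose E := [set t : 'I_P * 'I_P | edist (z t) m <= 100^-1]%SET.
have cardE : (q * q <= #|E|)%N.
  have lti (i : 'I_q) : (i0 + i < P)%N by apply: leq_trans i0P; rewrite ltn_add2l.
  have ltj (j : 'I_q) : (j0 + j < P)%N by apply: leq_trans j0P; rewrite ltn_add2l.
  pose h (ij : 'I_q * 'I_q) : 'I_P * 'I_P := (Ordinal (lti ij.1), Ordinal (ltj ij.2)).
  have h_inj : injective h.
    by move=> [i j] [i' j'] [] /addnI /val_inj -> /addnI /val_inj ->.
  have <- : #|[set h ij | ij : 'I_q * 'I_q]%SET| = (q * q)%N.
    by rewrite card_imset// card_prod card_ord.
  apply: subset_leq_card; apply/fintype.subsetP => _ /imsetP[[i j] _ ->].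
  (* Two coordinate offsets of at most 1/200 give a distance of at most [sqrt 2 / 200 < 1/100]. *)
  rewrite inE -ler_sqr ?nnegrE ?edist_ge0 ?invr_ge0// edist_vec2 /=.
  have := hi i (ltn_ord i); have := hj j (ltn_ord j); rewrite !ler_norml.
  move: (_ / _) (_ / _) => a b /andP[? ?] /andP[? ?]; nra.
apply: (@leq_trans (\sum_(t : 'I_P * 'I_P) (1 + (t \in E)))%N).
  rewrite big_split/= sum1_card card_prod card_ord leq_add2l.
  by rewrite (leq_trans cardE)// -sum1_card big_mkcond/=; apply: leq_sum => t _; case: ifP.
apply: leq_sum => t _; have [tE|_] := boolP (t \in E).
  move: tE; rewrite inE => /h12[zx1 zx2]; exact: count_ge2 x1X x2X x12 zx1 zx2.
rewrite addn0 -has_count.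
have [|x xX zx] := XC (z t); last by apply/hasP; exists x.
have bnd (i : 'I_P) : 0 <= (i%:R / K%:R : R) <= 8.
  have K0 : 0 < K%:R :> R by rewrite ltr0n KE muln_gt0.
  rewrite divr_ge0//= ler_pdivrMr// -natrM ler_nat -PE; exact: ltnW.
by rewrite /= vec2_0 vec2_1; have := bnd t.1; have := bnd t.2; lra.
Qed.

(** Double counting of the pairs of a lattice point and a ball of [X] containing it, with mesh
    [1 / K], [K = 100 q]: [delta] times the count for one ball is at most [(K + 2)^2], and each of
    the [n^2] squares of side 8 contributes at least [(8 K)^2 + q^2]. *)
Lemma euclidean_bound_count (delta : R) (X : seq 'rV[R]_2) (n q : nat) : (0 < q)%N ->
  0 <= delta ->
  (forall C : set 'rV[R]_2, bounded_borel C ->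
    (delta%:E * lebesgue_measure_rV C <= (cov C)%:E)%E) ->
  ball_cover X [set x | forall i, 0 <= x ord0 i <= 8 * n%:R] ->
  delta * (n%:R ^+ 2 * (64 * (100 * q%:R) ^+ 2 + q%:R ^+ 2)) <=
    (size X)%:R * (100 * q%:R + 2) ^+ 2.
Proof.
move=> q0 delta0 eb XC.
pose K := (100 * q)%N; pose P := (8 * K)%N.
have K0 : (0 < K)%N by rewrite muln_gt0.
have K0' : K%:R != 0 :> R by rewrite pnatr_eq0 -lt0n.
(* A lattice point is indexed by its square and its place there; [g] gives its global coordinates,
   from which division by [P] recovers the index. *)
pose T : finType := (('I_n * 'I_n) * ('I_P * 'I_P))%type.
pose g (t : T) := (t.1.1 * P + t.2.1, t.1.2 * P + t.2.2)%N.
have g_inj : injective g.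
  have inj1 (a a' : 'I_n) (i i' : 'I_P) : (a * P + i = a' * P + i')%N -> a = a' /\ i = i'.
    move=> e; have := congr1 (divn^~ P) e; have := congr1 (modn^~ P) e.
    have P0 : (0 < P)%N by rewrite muln_gt0.
    rewrite !modnMDl !modn_small// !divnMDl// !divn_small// !addn0.
    by move=> /val_inj -> /val_inj ->.
  by move=> [[a b] [i j]] [[a' b'] [i' j']] [] /inj1[-> ->] /inj1[-> ->].
pose D (x : 'rV[R]_2) :=
  [seq g t | t <- enum T & edist (lattice_point K (g t)) x < 1].
have sizeD x : delta * (size (D x))%:R <= (K%:R + 2) ^+ 2.
  apply: (@euclidean_bound_lattice _ _ _ x) => //.
    by rewrite map_inj_uniq// filter_uniq// enum_uniq.
  by move=> p /mapP[t]; rewrite mem_filter => /andP[h _] ->.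
have sumD : (\sum_(x <- X) size (D x) =
    \sum_(t : T) count (fun x => (edist (lattice_point K (g t)) x < 1)%R) X)%N.
  under eq_bigr => x _.
    rewrite size_map size_filter -sum1_count big_mkcond big_enum.
    over.
  rewrite exchange_big; apply: eq_big => // t _.
  by rewrite -sum1_count [in RHS]big_mkcond.
have cell_coord (a i : nat) : 8 * a%:R + i%:R / K%:R = (a * P + i)%:R / K%:R :> R.
  by rewrite natrD natrM (natrM R 8 K : P%:R = _); field.
have count_ge : (n * n * (P * P + q * q) <= \sum_(x <- X) size (D x))%N.
  rewrite sumD -(pair_bigA _ (fun u v =>
    count (fun x => (edist (lattice_point K (g (u, v))) x < 1)%R) X))/=.
  apply: (@leq_trans (\sum_(u : 'I_n * 'I_n) (P * P + q * q))%N).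
    by rewrite sum_nat_const card_prod card_ord.
  apply: leq_sum => -[a b] _.
  have cell (c : 'I_n) (y : R) : 8 * c%:R <= y <= 8 * c%:R + 8 -> 0 <= y <= 8 * n%:R.
    have : c%:R + 1 <= n%:R :> R by rewrite natr1 ler_nat.
    by have : 0 <= c%:R :> R by []; lra.
  have Xab : ball_cover X [set x | 8 * a%:R <= x ord0 ord0 <= 8 * a%:R + 8 /\
      8 * b%:R <= x ord0 ord1_2 <= 8 * b%:R + 8].
    by move=> x [/cell xa /cell xb]; apply: XC; exact: ord2P.
  apply: leq_trans (cell_count q0 erefl erefl Xab) _.
  apply: eq_leq; apply: eq_bigr => -[i j] _; apply: eq_count => x.
  congr (edist _ x < 1); rewrite /lattice_point /g/=; congr vec2;
    exact: cell_coord.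
have le1 : delta * (\sum_(x <- X) size (D x))%:R <= (size X)%:R * (K%:R + 2) ^+ 2.
  rewrite natr_sum mulr_sumr; apply: (@le_trans _ _ (\sum_(x <- X) (K%:R + 2) ^+ 2)).
    exact: ler_sum.
  by rewrite big_const_seq count_predT iter_addr_0 mulr_natl.
rewrite -natrM -/K; apply: le_trans le1; apply: ler_wpM2l => //.
move: count_ge; rewrite -(ler_nat R) => /(le_trans _); apply.
by rewrite natrM natrD !natrM le_eqVlt; apply/orP; left; apply/eqP; ring.
Qed.

End OverlapCount.

(** * The covering density of the plane *)

Section CubeCovering.
Context {R : realType}.

Lemma scale_unit_cubeP n (a : R) (x : 'rV[R]_n) : 0 < a ->
  set_scale a (@unit_cube R n) x <-> forall i, 0 <= x ord0 i <= a.
Proof.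
move=> a0; split=> [[y yc <-] i|xa].
  have /andP[y0 y1] := yc i; rewrite !mxE mulr_ge0 ?(ltW a0)//=.
  by rewrite ler_piMr// ltW.
exists (a^-1 *: x); last by rewrite scalerA mulfV ?scale1r// gt_eqF.
move=> i; have /andP[x0 x1] := xa i; rewrite !mxE mulr_ge0 ?invr_ge0 ?(ltW a0)//=.
by rewrite mulrC ler_pdivrMr// mul1r.
Qed.

Lemma bounded_scale_unit_cube n (a : R) : 0 < a ->
  bounded_set (set_scale a (@unit_cube R n)).
Proof.
move=> a0; apply/bounded_rowP; exists a => x /scale_unit_cubeP => /(_ a0) xa i.
by have /andP[x0 x1] := xa i; rewrite ger0_norm.
Qed.

(** The larger cube is a union of [2 ^ n] translates of the smaller one, so the densities along
    powers of 2 do not increase. *)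
Lemma cov_double_cube n (a : R) : 0 < a ->
  cov (set_scale (a + a) (@unit_cube R n)) <=
    2 ^+ n * cov (set_scale a (@unit_cube R n)).
Proof.
move=> a0; have [X [[_ XC <-] _]] := cov_attained (bounded_scale_unit_cube n a0).
pose w (b : {ffun 'I_n -> bool}) : 'rV[R]_n := \row_i (if b i then a else 0).
pose Y := [seq p + w b | p <- X, b <- enum {ffun 'I_n -> bool}].
have <- : (size Y)%:R = 2 ^+ n * (size X)%:R :> R.
  by rewrite size_allpairs -cardE card_ffun card_bool card_ord natrM natrX mulrC.
apply: cov_le => x /scale_unit_cubeP; rewrite addr_gt0// => /(_ isT) xa.
pose b : {ffun 'I_n -> bool} := [ffun i => a < x ord0 i].
have [|p pX xp] := XC (x - w b).
  apply/(scale_unit_cubeP _ a0) => i; rewrite !mxE ffunE.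
  by have /andP[x0 x1] := xa i; case: ltP => h; apply/andP; split; lra.
exists (p + w b); first by apply: allpairs_f => //; rewrite mem_enum.
by rewrite -(edistDr (- w b)) addrK.
Qed.

Lemma is_cvg_cov_density n :
  let u k := cov (set_scale (2 ^+ k) (@unit_cube R n)) / 2 ^+ (k * n) in
  {homo u : k l / (k <= l)%N >-> l <= k} /\ cvgn u.
Proof.
move=> u.
have u_dec : {homo u : k l / (k <= l)%N >-> l <= k}.
  apply/nonincreasing_seqP => k; rewrite /u mulSn exprD invfM mulrA ler_pM2r ?invr_gt0 ?exprn_gt0//.
  rewrite ler_pdivrMr ?exprn_gt0// mulrC exprS mulrDl mul1r.
  by apply: cov_double_cube; rewrite exprn_gt0.
split=> //; apply: nonincreasing_is_cvgn => //.
exists 0 => _ [k _ <-]; rewrite divr_ge0 ?exprn_ge0//.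
by apply/cov_ge0/bounded_scale_unit_cube; rewrite exprn_gt0.
Qed.

(** Points 2 apart never share an open unit ball, so sending each to a ball that covers it is
    injective. *)
Lemma separated_le_cov d (C : set 'rV[R]_d) (s : seq 'rV[R]_d) :
  bounded_set C -> uniq s -> {in s, forall x, C x} ->
  {in s &, forall x y, x != y -> 2 <= edist x y} -> (size s)%:R <= cov C.
Proof.
move=> bC us sC sep; have [X [[_ XC <-] _]] := cov_attained bC.
have /choice[g hg] : forall x, exists p, C x -> p \in X /\ edist x p < 1.
  move=> x; have [Cx|nCx] := pselect (C x); last by exists x.
  by have [p pX xp] := XC x Cx; exists p.
rewrite ler_nat -(size_map g); apply: uniq_leq_size.
  rewrite map_inj_in_uniq// => x y xs ys gxy; apply/eqP/negPn/negP => xy.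
  have := sep x y xs ys xy; have := edist_triangle (g x) x y.
  have [_ hx] := hg x (sC x xs); have [_ hy] := hg y (sC y ys).
  by rewrite {2}gxy (edistC (g y)); lra.
by move=> _ /mapP[x xs ->]; have [] := hg x (sC x xs).
Qed.

(** The [4 ^ k] points [pt t], with even coordinates, are 2 apart. The bound serves to make the
    covering density positive. *)
Lemma cov_square_ge k :
  4^-1 <= cov (set_scale (2 ^+ k.+1) (@unit_cube R 2)) / 2 ^+ (k.+1 * 2).
Proof.
pose N := (2 ^ k)%N.
pose pt (t : 'I_N * 'I_N) := vec2 (2 * t.1%:R) (2 * t.2%:R) : 'rV[R]_2.
pose s := [seq pt t | t <- enum {: 'I_N * 'I_N}].
have pow0 : 0 < 2 ^+ k.+1 :> R by rewrite exprn_gt0.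
have far (i j : 'I_N) : i != j -> 4 <= (2 * i%:R - 2 * j%:R) ^+ 2 :> R.
  rewrite neq_ltn => /orP[] ij.
    by have : i%:R + 1 <= j%:R :> R; [rewrite natr1 ler_nat|nra].
  by have : j%:R + 1 <= i%:R :> R; [rewrite natr1 ler_nat|nra].
have sep t t' : t != t' -> 2 <= edist (pt t) (pt t').
  move=> tt'; rewrite -ler_sqr ?nnegrE ?edist_ge0// edist_vec2 vec2_0 vec2_1.
  have [e1|/far h] := eqVneq t.1 t'.1; last first.
    by have := sqr_ge0 (2 * t.2%:R - 2 * t'.2%:R : R); lra.
  have [e2|/far h] := eqVneq t.2 t'.2; last first.
    by have := sqr_ge0 (2 * t.1%:R - 2 * t'.1%:R : R); lra.
  by move/eqP: tt'; case; rewrite (surjective_pairing t) e1 e2 -surjective_pairing.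
have pt_inj : injective pt.
  move=> t t' e; apply/eqP/negPn/negP => /sep; rewrite e edistxx; lra.
have le_s : (size s)%:R <= cov (set_scale (2 ^+ k.+1) (@unit_cube R 2)).
  apply: separated_le_cov.
  - exact: bounded_scale_unit_cube.
  - by rewrite map_inj_uniq// enum_uniq.
  - move=> _ /mapP[t _ ->]; apply/scale_unit_cubeP => //.
    have bnd (i : 'I_N) : 0 <= 2 * i%:R <= (2 ^+ k.+1 : R).
      rewrite mulr_ge0//= exprS ler_pM2l// -natrX ler_nat; exact: ltnW.
    by apply: ord2P; rewrite ?vec2_0 ?vec2_1; exact: bnd.
  - move=> _ _ /mapP[t _ ->] /mapP[t' _ ->] tt'; apply: sep.
    by apply: contra tt' => /eqP ->.
rewrite ler_pdivlMr ?exprn_gt0//; apply: le_trans le_s.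
rewrite size_map -cardE card_prod card_ord natrM natrX exprM (exprS 2 k).
by rewrite exprMn expr2 mulrA; lra.
Qed.

Lemma cov_not_euclidean_bound : ~ euclidean_bound (@cov R).
Proof.
move=> eb.
have [u_dec u_cvg] := is_cvg_cov_density 2.
set u := (fun k => _ / _) in u_dec u_cvg.
pose delta := pbf_density (@cov R) 2.
have delta_u : delta = limn u by [].
have delta0 : 4^-1 <= delta.
  by rewrite delta_u; apply: limr_ge => //; exists 1%N => // -[|k] // _; exact: cov_square_ge.
(* The inequality to be derived reduces to [q^2 <= 64 * (400 q + 4)], which fails for such [q]. *)
have [q q0 q1] : exists2 q, (0 < q)%N & 160 * 161 < q%:R :> R.
  by exists (Num.truncn (160 * 161 : R)).+1 => //; exact: truncnS_gt.
suff : delta * (64 * (100 * q%:R) ^+ 2 + q%:R ^+ 2) <=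
    64 * delta * (100 * q%:R + 2) ^+ 2.
  rewrite [64 * delta]mulrC -[leRHS]mulrA ler_pM2l; last by lra.
  nra.
rewrite [64 * delta]mulrC -[leRHS]mulrA -ler_pdivrMr; last by rewrite mulr_gt0// exprn_gt0; lra.
(* The left [delta] is the constant of the assumed bound; the right one is a limit, estimated
   through optimal coverings of squares of side [2 ^ k = 8 n], whence [3 <= k]. *)
rewrite {2}delta_u; apply: limr_ge => //; exists 3%N => // k /= k3.
pose n := (2 ^ (k - 3))%N.
have pow_k : 2 ^+ k = 8 * n%:R :> R.
  by rewrite -{1}(subnKC k3) exprD natrX; congr (_ * _); ring.
have pow0 : 0 < 2 ^+ k :> R by rewrite exprn_gt0.
have n0 : 0 < n%:R :> R by rewrite ltr0n expn_gt0.
have [X [[_ XC eX] _]] := cov_attained (bounded_scale_unit_cube 2 pow0).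
have XC' : ball_cover X [set x : 'rV[R]_2 | forall i, 0 <= x ord0 i <= 8 * n%:R].
  by move=> x xn; apply: XC; apply/scale_unit_cubeP => //; rewrite pow_k.
have delta_ge0 : 0 <= delta by lra.
have := euclidean_bound_count q0 delta_ge0 (fun C => eb 2%N C isT) XC'.
rewrite eX /u exprM pow_k => h.
rewrite ler_pdivrMr; last by rewrite mulr_gt0// exprn_gt0; lra.
have n2 : 0 < n%:R ^+ 2 :> R by rewrite exprn_gt0.
have -> : cov (set_scale (8 * n%:R) (@unit_cube R 2)) / (8 * n%:R) ^+ 2 *
    (64 * (100 * q%:R + 2) ^+ 2) =
    cov (set_scale (8 * n%:R) (@unit_cube R 2)) * (100 * q%:R + 2) ^+ 2 / n%:R ^+ 2.
  by field; rewrite gt_eqF.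
by rewrite ler_pdivlMr// -mulrA [_ * n%:R ^+ 2]mulrC.
Qed.

End CubeCovering.

Theorem proposition2p10 (R : realType) :
  [/\ packing_bound_function (@cov R),
      forall A : borel_set_function R, packing_bound_function A ->
        forall d (C : set 'rV[R]_d), bounded_borel C -> (A d C <= cov C)%R
    & ~ euclidean_bound (@cov R)].
Proof.
split; [exact: cov_packing_bound_function|exact: pbf_le_cov|].
exact: cov_not_euclidean_bound.
Qed.
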